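(* Let $\Lambda$ be a set of standard formulas closed under standard substitution. For every formula $\phi$ of the inquisitive language $\mathcal{L}$ (built from $\wedge,\vee,\to,\bot$), we have $\phi\in \mathtt{inq}\Lambda$ if and only if $\phi$ is valid (under core semantics) in every $\mathtt{inq}\Lambda$-algebra. Likewise, for every formula $\phi$ of the dependence language $\mathcal{L}^{\otimes}$ (built from $\wedge,\vee,\to,\otimes,\bot$), we have $\phi\in \mathtt{inq}\Lambda^{\otimes}$ if and only if $\phi$ is valid (under core semantics) in every $\mathtt{inq}\Lambda^{\otimes}$-algebra.
   Context: Fix a countable set of propositional atoms. Let $\mathcal{L}$ be the set of formulas generated by $\phi::=p\mid\bot\mid\phi\wedge\phi\mid\phi\vee\phi\mid\phi\to\phi$, and $\mathcal{L}^{\otimes}$ the set of formulas generated by the same grammar plus $\phi\otimes\phi$ (tensor disjunction). A formula is standard if it contains no $\vee$; write $\mathcal{L}_{\mathrm{st}}$, $\mathcal{L}^{\otimes}_{\mathrm{st}}$ for the standard formulas. A set of formulas is closed under standard substitution if it is closed under every substitution of standard formulas for atoms. Intuitionistic inquisitive logic $\mathtt{inqI}$ is the smallest set of formulas of $\mathcal{L}$ containing all instances of the usual Hilbert axioms of intuitionistic propositional logic together with the Split axiom $(\alpha\to(\phi\vee\psi))\to((\alpha\to\phi)\vee(\alpha\to\psi))$ for $\alpha$ standard, and closed under modus ponens. Intuitionistic dependence logic $\mathtt{inqI}^{\otimes}$ is the smallest set of formulas of $\mathcal{L}^{\otimes}$ containing these axioms (Split for $\alpha\in\mathcal{L}^{\otimes}_{\mathrm{st}}$)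 and, for arbitrary $\phi,\psi,\chi,\tau$ and standard $\alpha,\beta,\gamma$: $\alpha\to(\alpha\otimes\beta)$; $(\alpha\otimes\beta)\to(\beta\otimes\alpha)$; $\phi\otimes(\psi\vee\chi)\to(\phi\otimes\psi)\vee(\phi\otimes\chi)$; $(\phi\to\chi)\to((\psi\to\tau)\to(\phi\otimes\psi\to\chi\otimes\tau))$; $(\alpha\to\gamma)\to((\beta\to\gamma)\to(\alpha\otimes\beta\to\gamma))$; closed under modus ponens. For $\Lambda\subseteq\mathcal{L}_{\mathrm{st}}$ closed under standard substitution, the intermediate inquisitive logic $\mathtt{inq}\Lambda$ is the closure of $\mathtt{inqI}\cup\Lambda$ under modus ponens; for $\Lambda\subseteq\mathcal{L}^{\otimes}_{\mathrm{st}}$ closed under standard substitution, the intermediate dependence logic $\mathtt{inq}\Lambda^{\otimes}$ is the closure of $\mathtt{inqI}^{\otimes}\cup\Lambda$ under modus ponens. An inquisitive algebra is a structure $\mathcal{A}=(A,A_c,\wedge,\vee,\to,0)$ with a distinguished subset $A_c\subseteq A$ (the core) such that: the closure $\langle A_c\rangle$ of $A_c$ under $\wedge,\vee,\to,0$ is a Heyting algebra; $(A_c,\wedge,\to,0)$ is a Brouwerian semilattice; and for all $x,y\in\langle A_c\rangle$, $a\in A_c$: $a\to(x\vee y)=(a\to x)\vee(a\to y)$. A dependence algebra is a structure $(A,A_c,\wedge,\otimes,\vee,\to,0)$ such that $\langle A_c\rangle$ (closure under $\vee,\otimes,\wedge,\to,0$) is a Heyting algebra, $(A_c,\otimes,\wedge,\to,0)$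 is a Heyting algebra (with $\otimes$ as join), and for all $x,y,z,k\in\langle A_c\rangle$, $a\in A_c$: $a\to(x\vee y)=(a\to x)\vee(a\to y)$, $x\otimes(y\vee z)=(x\otimes y)\vee(x\otimes z)$, and $(x\to z)\to(y\to k)=(x\otimes y)\to(z\otimes k)$. A core valuation on such an algebra is a map $\mu$ from atoms into $A_c$. The interpretation of formulas in the model $(\mathcal{A},\mu)$ is defined recursively: an atom $p$ is interpreted as $\mu(p)$, $\bot$ as $0$, and $\wedge,\vee,\to$ (and $\otimes$ for dependence algebras) are interpreted by the corresponding algebra operations. A formula is true in $(\mathcal{A},\mu)$ if its interpretation equals $1:=0\to0$, and valid (under core semantics) in $\mathcal{A}$ if it is true in $(\mathcal{A},\mu)$ for every core valuation $\mu$. An inquisitive algebra is an $\mathtt{inq}\Lambda$-algebra if every formula of $\Lambda$ is valid in it; a dependence algebra is an $\mathtt{inq}\Lambda^{\otimes}$-algebra if every formula of $\Lambda$ is valid in it.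
   Formalization: In the definition of dependence algebra, the condition (x→z)→(y→k) = (x⊗y)→(z⊗k), which forces 0 = 1, is replaced by (x→z)→((y→k)→((x⊗y)→(z⊗k))) = 1, the algebraic form of the logic's monotonicity axiom for ⊗. *)

(* Defs.v *)
From mathcomp Require Import all_boot.

Set Implicit Arguments.
Unset Strict Implicit.
Unset Printing Implicit Defensive.

Inductive mp_closure (F : Type) (imp : F -> F -> F) (S : F -> Prop) : F -> Prop :=
| mp_base f : S f -> mp_closure imp S f
| mp_step f g : mp_closure imp S (imp f g) -> mp_closure imp S f ->
                mp_closure imp S g.

Inductive ipl_axiom (F : Type) (bot : F) (and or imp : F -> F -> F) : F -> Prop :=
| ipl_k f g : ipl_axiom bot and or imp (imp f (imp g f))
| ipl_s f g h : ipl_axiom bot and or imp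
    (imp (imp f (imp g h)) (imp (imp f g) (imp f h)))
| ipl_andl f g : ipl_axiom bot and or imp (imp (and f g) f)
| ipl_andr f g : ipl_axiom bot and or imp (imp (and f g) g)
| ipl_andi f g : ipl_axiom bot and or imp (imp f (imp g (and f g)))
| ipl_orl f g : ipl_axiom bot and or imp (imp f (or f g))
| ipl_orr f g : ipl_axiom bot and or imp (imp g (or f g))
| ipl_ore f g h : ipl_axiom bot and or imp
    (imp (imp f h) (imp (imp g h) (imp (or f g) h)))
| ipl_bot f : ipl_axiom bot and or imp (imp bot f).

(* Brouwerian semilattices and Heyting algebras carried by a subset D of A;
   the order is the one of the meet operation. *)

Record brouwerian_on (A : Type) (D : A -> Prop)
    (meet imp : A -> A -> A) (bot : A) : Prop := BrouwerianOn {
  bs_bot_in : D bot;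
  bs_meet_in : forall x y, D x -> D y -> D (meet x y);
  bs_imp_in : forall x y, D x -> D y -> D (imp x y);
  bs_meetxx : forall x, D x -> meet x x = x;
  bs_meetC : forall x y, D x -> D y -> meet x y = meet y x;
  bs_meetA : forall x y z, D x -> D y -> D z ->
    meet x (meet y z) = meet (meet x y) z;
  bs_bot_le : forall x, D x -> meet bot x = bot;
  bs_residuation : forall x y z, D x -> D y -> D z ->
    meet (meet z x) y = meet z x <-> meet z (imp x y) = z
}.

Record heyting_on (A : Type) (D : A -> Prop)
    (meet join imp : A -> A -> A) (bot : A) : Prop := HeytingOn {
  ha_brouwerian : brouwerian_on D meet imp bot;
  ha_join_in : forall x y, D x -> D y -> D (join x y);
  ha_joinC : forall x y, D x -> D y -> join x y = join y x;
  ha_joinA : forall x y z, D x -> D y -> D z ->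
    join x (join y z) = join (join x y) z;
  ha_meetKU : forall x y, D x -> D y -> join x (meet x y) = x;
  ha_joinKI : forall x y, D x -> D y -> meet x (join x y) = x
}.

(** Inquisitive logic *)

Inductive form (V : Type) : Type :=
| Atom of V
| Bot
| And of form V & form V
| Or of form V & form V
| Imp of form V & form V.

Arguments Bot {V}.

Fixpoint standard (V : Type) (f : form V) : bool :=
  match f with
  | Atom _ | Bot => true
  | And g h | Imp g h => standard g && standard h
  | Or _ _ => false
  end.

Fixpoint subst (V : Type) (s : V -> form V) (f : form V) : form V :=
  match f with
  | Atom p => s p
  | Bot => Bot
  | And g h => And (subst s g) (subst s h)
  | Or g h => Or (subst s g) (subst s h)
  | Imp g h => Imp (subst s g) (subst s h)
  end.

Definition closed_std_subst (V : Type) (L : form V -> Prop) : Prop :=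
  forall s : V -> form V, (forall p, standard (s p)) ->
  forall f, L f -> L (subst s f).

Inductive inqI_axiom (V : Type) : form V -> Prop :=
| inqI_ipl f : ipl_axiom Bot (@And V) (@Or V) (@Imp V) f -> inqI_axiom f
| inqI_split a f g : standard a ->
    inqI_axiom (Imp (Imp a (Or f g)) (Or (Imp a f) (Imp a g))).

Definition inqI (V : Type) : form V -> Prop :=
  mp_closure (@Imp V) (@inqI_axiom V).

Definition inq (V : Type) (L : form V -> Prop) : form V -> Prop :=
  mp_closure (@Imp V) (fun f => inqI f \/ L f).

Inductive inq_generated (A : Type) (core : A -> Prop)
    (meet join imp : A -> A -> A) (bot : A) : A -> Prop :=
| ig_core a : core a -> inq_generated core meet join imp bot a
| ig_bot : inq_generated core meet join imp bot bot
| ig_meet x y : inq_generated core meet join imp bot x ->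
    inq_generated core meet join imp bot y ->
    inq_generated core meet join imp bot (meet x y)
| ig_join x y : inq_generated core meet join imp bot x ->
    inq_generated core meet join imp bot y ->
    inq_generated core meet join imp bot (join x y)
| ig_imp x y : inq_generated core meet join imp bot x ->
    inq_generated core meet join imp bot y ->
    inq_generated core meet join imp bot (imp x y).

Record inqAlgebra : Type := InqAlgebra {
  ia_sort :> Type;
  ia_core : ia_sort -> Prop;
  ia_meet : ia_sort -> ia_sort -> ia_sort;
  ia_join : ia_sort -> ia_sort -> ia_sort;
  ia_imp : ia_sort -> ia_sort -> ia_sort;
  ia_bot : ia_sort;
  ia_gen := inq_generated ia_core ia_meet ia_join ia_imp ia_bot;
  ia_heyting : heyting_on ia_gen ia_meet ia_join ia_imp ia_bot;
  ia_brouwerian : brouwerian_on ia_core ia_meet ia_imp ia_bot;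
  ia_split : forall a x y, ia_core a -> ia_gen x -> ia_gen y ->
    ia_imp a (ia_join x y) = ia_join (ia_imp a x) (ia_imp a y)
}.

Definition ia_top (A : inqAlgebra) : A := ia_imp (ia_bot A) (ia_bot A).

Fixpoint ia_eval (V : Type) (A : inqAlgebra) (mu : V -> A) (f : form V) : A :=
  match f with
  | Atom p => mu p
  | Bot => ia_bot A
  | And g h => ia_meet (ia_eval mu g) (ia_eval mu h)
  | Or g h => ia_join (ia_eval mu g) (ia_eval mu h)
  | Imp g h => ia_imp (ia_eval mu g) (ia_eval mu h)
  end.

Definition ia_valid (V : Type) (A : inqAlgebra) (f : form V) : Prop :=
  forall mu : V -> A, (forall p, ia_core (mu p)) -> ia_eval mu f = ia_top A.

Definition is_inq_algebra (V : Type) (L : form V -> Prop) (A : inqAlgebra) : Prop :=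
  forall f, L f -> ia_valid A f.

(** Dependence logic *)

Inductive dform (V : Type) : Type :=
| DAtom of V
| DBot
| DAnd of dform V & dform V
| DOr of dform V & dform V
| DImp of dform V & dform V
| DTen of dform V & dform V.

Arguments DBot {V}.

Fixpoint dstandard (V : Type) (f : dform V) : bool :=
  match f with
  | DAtom _ | DBot => true
  | DAnd g h | DImp g h | DTen g h => dstandard g && dstandard h
  | DOr _ _ => false
  end.

Fixpoint dsubst (V : Type) (s : V -> dform V) (f : dform V) : dform V :=
  match f with
  | DAtom p => s p
  | DBot => DBot
  | DAnd g h => DAnd (dsubst s g) (dsubst s h)
  | DOr g h => DOr (dsubst s g) (dsubst s h)
  | DImp g h => DImp (dsubst s g) (dsubst s h)
  | DTen g h => DTen (dsubst s g) (dsubst s h)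
  end.

Definition dclosed_std_subst (V : Type) (L : dform V -> Prop) : Prop :=
  forall s : V -> dform V, (forall p, dstandard (s p)) ->
  forall f, L f -> L (dsubst s f).

Inductive dinqI_axiom (V : Type) : dform V -> Prop :=
| dinqI_ipl f : ipl_axiom DBot (@DAnd V) (@DOr V) (@DImp V) f -> dinqI_axiom f
| dinqI_split a f g : dstandard a ->
    dinqI_axiom (DImp (DImp a (DOr f g)) (DOr (DImp a f) (DImp a g)))
| dinqI_ten_intro a b : dstandard a -> dstandard b ->
    dinqI_axiom (DImp a (DTen a b))
| dinqI_ten_comm a b : dstandard a -> dstandard b ->
    dinqI_axiom (DImp (DTen a b) (DTen b a))
| dinqI_ten_dist f g h :
    dinqI_axiom (DImp (DTen f (DOr g h)) (DOr (DTen f g) (DTen f h)))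
| dinqI_ten_mon f g h k :
    dinqI_axiom (DImp (DImp f h) (DImp (DImp g k) (DImp (DTen f g) (DTen h k))))
| dinqI_ten_elim a b c : dstandard a -> dstandard b -> dstandard c ->
    dinqI_axiom (DImp (DImp a c) (DImp (DImp b c) (DImp (DTen a b) c))).

Definition dinqI (V : Type) : dform V -> Prop :=
  mp_closure (@DImp V) (@dinqI_axiom V).

Definition dinq (V : Type) (L : dform V -> Prop) : dform V -> Prop :=
  mp_closure (@DImp V) (fun f => dinqI f \/ L f).

Inductive dep_generated (A : Type) (core : A -> Prop)
    (meet join imp ten : A -> A -> A) (bot : A) : A -> Prop :=
| dg_core a : core a -> dep_generated core meet join imp ten bot a
| dg_bot : dep_generated core meet join imp ten bot bot
| dg_meet x y : dep_generated core meet join imp ten bot x ->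
    dep_generated core meet join imp ten bot y ->
    dep_generated core meet join imp ten bot (meet x y)
| dg_join x y : dep_generated core meet join imp ten bot x ->
    dep_generated core meet join imp ten bot y ->
    dep_generated core meet join imp ten bot (join x y)
| dg_imp x y : dep_generated core meet join imp ten bot x ->
    dep_generated core meet join imp ten bot y ->
    dep_generated core meet join imp ten bot (imp x y)
| dg_ten x y : dep_generated core meet join imp ten bot x ->
    dep_generated core meet join imp ten bot y ->
    dep_generated core meet join imp ten bot (ten x y).

(* Writing * for the tensor: its monotonicity condition is sometimes printed as
     (x -> z) -> (y -> k) = (x * y) -> (z * k).
   Taken literally, this forces 1 = 0, hence a one-element generated subalgebra
   in which every formula is valid (literal_mon_collapse below).  The condition
   da_mon is the algebraic counterpart of the axiom dinqI_ten_mon: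
     (x -> z) -> ((y -> k) -> ((x * y) -> (z * k))) = 1. *)
Record depAlgebra : Type := DepAlgebra {
  da_sort :> Type;
  da_core : da_sort -> Prop;
  da_meet : da_sort -> da_sort -> da_sort;
  da_join : da_sort -> da_sort -> da_sort;
  da_imp : da_sort -> da_sort -> da_sort;
  da_ten : da_sort -> da_sort -> da_sort;
  da_bot : da_sort;
  da_gen := dep_generated da_core da_meet da_join da_imp da_ten da_bot;
  da_heyting : heyting_on da_gen da_meet da_join da_imp da_bot;
  da_core_heyting : heyting_on da_core da_meet da_ten da_imp da_bot;
  da_split : forall a x y, da_core a -> da_gen x -> da_gen y ->
    da_imp a (da_join x y) = da_join (da_imp a x) (da_imp a y);
  da_dist : forall x y z, da_gen x -> da_gen y -> da_gen z ->
    da_ten x (da_join y z) = da_join (da_ten x y) (da_ten x z);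
  da_mon : forall x y z k, da_gen x -> da_gen y -> da_gen z -> da_gen k ->
    da_imp (da_imp x z) (da_imp (da_imp y k) (da_imp (da_ten x y) (da_ten z k)))
    = da_imp da_bot da_bot
}.

Lemma literal_mon_collapse (A : Type) (core : A -> Prop)
    (meet ten imp : A -> A -> A) (bot : A) :
  heyting_on core meet ten imp bot ->
  (forall x y z k, core x -> core y -> core z -> core k ->
     imp (imp x z) (imp y k) = imp (ten x y) (ten z k)) ->
  forall x, core x -> x = bot.
Proof.
move=> [[b0 bm bi mxx mC mA b_le res] tin tC tA tKU tKI] mon.
set one := imp bot bot.
have cone : core one by apply: bi.
have le1 x : core x -> meet x one = x.
  move=> cx; apply/res => //.
  have e : meet x bot = bot by rewrite mC // b_le.
  by rewrite e mxx.
have one_ten x : core x -> ten one x = one.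
  move=> cx; have ctx := tin _ _ cone cx.
  by rewrite -(le1 _ ctx) mC // tKI.
have impxx x : core x -> imp x x = one.
  move=> cx.
  have h : meet one (imp x x) = one by apply/res => //; rewrite -mA // mxx.
  by rewrite -h mC ?le1 //; apply: bi.
have imp1 x : core x -> imp one x = meet (imp one x) x.
  move=> cx; have cix := bi _ _ cone cx.
  have /res h : meet (imp one x) (imp one x) = imp one x by rewrite mxx.
  by rewrite -{1}(le1 (imp one x)) // -h // le1.
have one_bot : one = bot.
  have := mon one one one bot cone cone cone b0.
  have e : imp one bot = bot by rewrite imp1 // mC // ?b_le //; apply: bi.
  by rewrite !one_ten // impxx // !e => ->.
by move=> x cx; rewrite -(le1 x cx) one_bot mC // b_le.
Qed.

Definition da_top (A : depAlgebra) : A := da_imp (da_bot A) (da_bot A).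

Fixpoint da_eval (V : Type) (A : depAlgebra) (mu : V -> A) (f : dform V) : A :=
  match f with
  | DAtom p => mu p
  | DBot => da_bot A
  | DAnd g h => da_meet (da_eval mu g) (da_eval mu h)
  | DOr g h => da_join (da_eval mu g) (da_eval mu h)
  | DImp g h => da_imp (da_eval mu g) (da_eval mu h)
  | DTen g h => da_ten (da_eval mu g) (da_eval mu h)
  end.

Definition da_valid (V : Type) (A : depAlgebra) (f : dform V) : Prop :=
  forall mu : V -> A, (forall p, da_core (mu p)) -> da_eval mu f = da_top A.

Definition is_dinq_algebra (V : Type) (L : dform V -> Prop) (A : depAlgebra) : Prop :=
  forall f, L f -> da_valid A f.

(* Main.v *)
Require Import Defs.
From Stdlib Require Import FunctionalExtensionality PropExtensionality.
From Stdlib Require Import IndefiniteDescription.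
From mathcomp Require Import all_boot.

Set Implicit Arguments.
Unset Strict Implicit.
Unset Printing Implicit Defensive.

(** Soundness is an induction on derivations: standard formulas take values in
    the core, all formulas take values in the generated subalgebra, so each
    axiom only meets elements for which the algebra laws are postulated.

    Completeness is the Lindenbaum construction.  Its carrier is the type of all
    sets of formulas, with the connectives lifted pointwise modulo provable
    equivalence, and its core is the set of equivalence classes of standard
    formulas.  Sets that are not equivalence classes are harmless, because the
    algebra laws only concern the subalgebra generated by the core, which
    consists of equivalence classes.  A core valuation is induced by a standard
    substitution, so closure under such substitutions makes the formulas of
    [L] valid. *)

(** * Heyting algebras carried by a subset *)

Section BrouwerianTheory.
Variables (A : Type) (D : A -> Prop) (meet imp : A -> A -> A) (bot : A).
Hypothesis brouwer : brouwerian_on D meet imp bot.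

Local Notation le x y := (meet x y = x).
Local Notation top := (imp bot bot).

Lemma top_in : D top.
Proof. by case: brouwer => b0 _ bi *; apply: bi. Qed.

Lemma le_top x : D x -> le x top.
Proof.
case: brouwer => b0 bm bi mxx mC mA b_le res Dx; apply/res => //.
by rewrite (mC x) // b_le // mxx.
Qed.

Lemma le_trans_on y x z : D x -> D y -> D z -> le x y -> le y z -> le x z.
Proof.
by case: brouwer => b0 bm bi mxx mC mA _ _ Dx Dy Dz xy yz; rewrite -xy -mA ?yz.
Qed.

Lemma meet_lel x y : D x -> D y -> le (meet x y) x.
Proof.
by case: brouwer => b0 bm bi mxx mC mA *; rewrite mC ?mA ?mxx //; apply: bm.
Qed.

Lemma meet_ler x y : D x -> D y -> le (meet x y) y.
Proof. by case: brouwer => b0 bm bi mxx mC mA *; rewrite -mA ?mxx. Qed.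

Lemma le_imp x y z : D x -> D y -> D z -> le (meet z x) y -> le z (imp x y).
Proof. by move=> Dx Dy Dz; case: (bs_residuation brouwer Dx Dy Dz). Qed.

Lemma le_imp_mp x y z :
  D x -> D y -> D z -> le z (imp x y) -> le z x -> le z y.
Proof.
case: (brouwer) => b0 bm bi mxx mC mA b_le res Dx Dy Dz /res zxy zx.
by rewrite -zx zxy.
Qed.

(** Residuation at [z = top], where [top] is neutral for [meet]. Truth of an implication thereby
    becomes an order statement. *)
Lemma imp_topP x y : D x -> D y -> imp x y = top <-> le x y.
Proof.
case: (brouwer) => b0 bm bi mxx mC mA b_le res Dx Dy.
have Dt := top_in; have Dxy := bi _ _ Dx Dy.
have top_meet z : D z -> meet top z = z by move=> Dz; rewrite mC ?le_top.
have -> : imp x y = top <-> le top (imp x y) by rewrite top_meet.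
by rewrite -res // top_meet.
Qed.

Lemma imp_top_mp x y : D x -> D y -> imp x y = top -> x = top -> y = top.
Proof.
case: (brouwer) => b0 bm bi mxx mC mA b_le res Dx Dy /imp_topP/[swap] ->.
by rewrite mC ?le_top //; [apply; [apply: top_in|]|apply: top_in].
Qed.

End BrouwerianTheory.

(** * Joins, and validity of the intuitionistic axioms *)

Section HeytingTheory.
Variables (A : Type) (D : A -> Prop) (meet join imp : A -> A -> A) (bot : A).
Hypothesis hey : heyting_on D meet join imp bot.

Local Notation le x y := (meet x y = x).
Local Notation top := (imp bot bot).

(** By absorption, [le t z] gives [join t z = z]; hence [z = join (join x y) z], an element above
    [join x y]. *)
Lemma join_lub x y z :
  D x -> D y -> D z -> le x z -> le y z -> le (join x y) z.
Proof.
case: hey => [[b0 bm bi mxx mC mA b_le res] jin jC jA KU KI] Dx Dy Dz xz yz.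
have joinz t : D t -> le t z -> join t z = z.
  by move=> Dt tz; rewrite jC // -{2}(KU z t) // (mC z) // tz.
have -> : z = join (join x y) z by rewrite -jA // !joinz.
by apply: KI => //; apply: jin.
Qed.

Lemma join_intro_top x y : D x -> D y -> imp x (join x y) = top.
Proof.
have brouwer := ha_brouwerian hey; case: hey => _ jin _ _ _ KI Dx Dy.
by apply/(imp_topP brouwer); auto.
Qed.

Lemma join_elim_top x y z : D x -> D y -> D z ->
  imp (imp x z) (imp (imp y z) (imp (join x y) z)) = top.
Proof.
have brouwer := ha_brouwerian hey.
case: (hey) => [[b0 bm bi mxx mC mA b_le res] jin jC jA KU KI] Dx Dy Dz.
have Dxz := bi _ _ Dx Dz; have Dyz := bi _ _ Dy Dz; have Dj := jin _ _ Dx Dy.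
apply/(imp_topP brouwer); auto; apply: (le_imp brouwer); auto; apply: (le_imp brouwer); auto.
(* [w] collects the two premises. Residuation moves [w] across, leaving [x] and [y] each below
   [imp w z], so [join_lub] applies without any distributive law. *)
set w := meet _ (imp y z); have Dw : D w by apply: bm.
have le_w t : D t -> le w (imp t z) -> le t (imp w z).
  by move=> Dt wt; apply: (le_imp brouwer); rewrite // (mC t) //; apply/res.
rewrite (mC w) //; apply/res => //; apply: join_lub; auto; apply: le_w => //.
  exact: (meet_lel brouwer).
exact: (meet_ler brouwer).
Qed.

(** The syntax and the evaluation map [e] stay abstract so that one argument serves both
    languages. *)
Lemma ipl_axiom_sound (F : Type) (botF : F) (andF orF impF : F -> F -> F)
    (e : F -> A) f :
  (forall g, D (e g)) -> e botF = bot ->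
  {morph e : g h / andF g h >-> meet g h} ->
  {morph e : g h / orF g h >-> join g h} ->
  {morph e : g h / impF g h >-> imp g h} ->
  ipl_axiom botF andF orF impF f -> e f = top.
Proof.
move=> De e0 eM eJ eI.
have brouwer := ha_brouwerian hey.
case: (hey) => [[b0 bm bi mxx mC mA b_le res] jin jC jA KU KI].
case=> [g h|g h k|g h|g h|g h|g h|g h|g h k|g]; rewrite ?eI ?eM ?eJ ?e0.
- apply/(imp_topP brouwer); auto; apply: (le_imp brouwer); auto.
  exact: (meet_lel brouwer).
- apply/(imp_topP brouwer); auto; apply: (le_imp brouwer); auto; apply: (le_imp brouwer); auto.
  set p := imp (e g) (imp _ _); set q := imp (e g) (e h).
  have Dp : D p by rewrite /p; auto.
  have Dq : D q by rewrite /q; auto.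
  set w := meet _ (e g); have Dw : D w by rewrite /w; auto.
  have wpq : le w (meet p q) by apply: (meet_lel brouwer); auto.
  have wg : le w (e g) by apply: (meet_ler brouwer); auto.
  have wp : le w p.
    by apply: (le_trans_on brouwer _ _ _ wpq); auto; apply: (meet_lel brouwer).
  have wq : le w q.
    by apply: (le_trans_on brouwer _ _ _ wpq); auto; apply: (meet_ler brouwer).
  have wh : le w (e h) by apply: (le_imp_mp brouwer _ _ _ wq wg).
  have whk : le w (imp (e h) (e k)).
    by apply: (le_imp_mp brouwer _ _ _ wp wg); auto.
  by apply: (le_imp_mp brouwer _ _ _ whk wh).
- by apply/(imp_topP brouwer); auto; apply: (meet_lel brouwer).
- by apply/(imp_topP brouwer); auto; apply: (meet_ler brouwer).
- by apply/(imp_topP brouwer); auto; apply: (le_imp brouwer); auto; rewrite mxx; auto.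
- exact: join_intro_top.
- by rewrite jC //; apply: join_intro_top.
- exact: join_elim_top.
- by apply/(imp_topP brouwer); auto.
Qed.

End HeytingTheory.

(** * Soundness of both logics *)

Lemma mp_closure_sound (F A : Type) (D : A -> Prop) meet imp bot
    (impF : F -> F -> F) (S : F -> Prop) (e : F -> A) f :
  brouwerian_on D meet imp bot -> (forall g, D (e g)) ->
  {morph e : g h / impF g h >-> imp g h} ->
  (forall g, S g -> e g = imp bot bot) ->
  mp_closure impF S f -> e f = imp bot bot.
Proof.
move=> brouwer De eI sound_S; elim=> [g /sound_S //|g h _ gh _ g_top].
by apply: (imp_top_mp brouwer (De g)); rewrite -?eI.
Qed.

Lemma inq_sound (V : Type) (L : form V -> Prop) (A : inqAlgebra) f :
  is_inq_algebra L A -> inq L f -> ia_valid A f.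
Proof.
move=> AL Lf mu mu_core.
have hey := ia_heyting A; have brouwer := ha_brouwerian hey.
have gen g : ia_gen (ia_eval mu g).
  elim: g => [p||g ? h ?|g ? h ?|g ? h ?]; rewrite /ia_gen /=.
  - exact: ig_core.
  - exact: ig_bot.
  - exact: ig_meet.
  - exact: ig_join.
  - exact: ig_imp.
have core g : standard g -> ia_core (ia_eval mu g).
  case: (ia_brouwerian A) => b0 bm bi _ _ _ _ _.
  by elim: g => //= g IHg h IHh /andP[/IHg ? /IHh ?]; auto.
apply: (mp_closure_sound (e := ia_eval mu) brouwer) Lf => // g [|/AL]; last exact.
(* Two closures are nested: the outer one over [inqI] and [L], the inner one over the axioms. The
   same lemma peels off each. *)
apply: (mp_closure_sound (e := ia_eval mu) brouwer) => // {}g.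
case=> [{}g|a g1 g2 /core ca]; first exact: (ipl_axiom_sound hey).
have [_ bm bi mxx _ _ _ _] := brouwer; have jin := ha_join_in hey.
have [[ga g1_gen] g2_gen] := (gen a, gen g1, gen g2).
rewrite /= (ia_split ca) //.
by apply/(imp_topP brouwer); [auto|auto|rewrite mxx; auto].
Qed.

Lemma dinq_sound (V : Type) (L : dform V -> Prop) (A : depAlgebra) f :
  is_dinq_algebra L A -> dinq L f -> da_valid A f.
Proof.
move=> AL Lf mu mu_core.
have hey := da_heyting A; have brouwer := ha_brouwerian hey.
have core_hey := da_core_heyting A.
have core_brouwer := ha_brouwerian core_hey.
have gen g : da_gen (da_eval mu g).
  elim: g => [p||g ? h ?|g ? h ?|g ? h ?|g ? h ?]; rewrite /da_gen /=.
  - exact: dg_core.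
  - exact: dg_bot.
  - exact: dg_meet.
  - exact: dg_join.
  - exact: dg_imp.
  - exact: dg_ten.
have core g : dstandard g -> da_core (da_eval mu g).
  case: (core_hey) => [[b0 bm bi _ _ _ _ _] tin _ _ _ _].
  by elim: g => //= g IHg h IHh /andP[/IHg ? /IHh ?]; auto.
apply: (mp_closure_sound (e := da_eval mu) brouwer) Lf => // g [|/AL]; last exact.
apply: (mp_closure_sound (e := da_eval mu) brouwer) => // {}g.
have [_ bm bi mxx _ _ _ _] := brouwer; have jin := ha_join_in hey.
have imp_refl x : da_gen x -> da_imp x x = da_top A.
  by move=> Dx; apply/(imp_topP brouwer) => //; apply: mxx.
case=> [{}g|a g1 g2 /core ca|a b /core ca /core cb|a b /core ca /core cb
  |g1 g2 g3|g1 g2 g3 g4|a b c /core ca /core cb /core cc] /=.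
- exact: (ipl_axiom_sound hey).
- by rewrite (da_split ca) //; apply: imp_refl; auto.
(* The core and the whole algebra share the top [imp bot bot], so a join law of the core yields
   truth in the algebra. *)
- exact: (join_intro_top core_hey).
- rewrite (ha_joinC core_hey) //; apply: imp_refl; apply: dg_ten; apply: gen.
- rewrite da_dist //; apply: imp_refl; apply: jin; apply: dg_ten; apply: gen.
- exact: da_mon.
- exact: (join_elim_top core_hey).
Qed.

(** * The Lindenbaum algebra *)

Section Lindenbaum.
Variables (F : Type) (bot : F) (and or imp : F -> F -> F) (T : F -> Prop).
Hypothesis T_ipl : forall f, ipl_axiom bot and or imp f -> T f.
Hypothesis T_mp : forall f g, T (imp f g) -> T f -> T g.

Local Notation "f |- g" := (T (imp f g)) (at level 70, no associativity).

Lemma entails_weaken f g : T g -> f |- g.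
Proof. by apply: T_mp; apply: T_ipl; apply: ipl_k. Qed.

Lemma entails_mp f g h : f |- imp g h -> f |- g -> f |- h.
Proof. by move=> fgh; apply: T_mp; apply: T_mp fgh; apply: T_ipl; apply: ipl_s. Qed.

Lemma entails_refl f : f |- f.
Proof. by apply: (@entails_mp _ (imp f f)); apply: T_ipl; apply: ipl_k. Qed.

Lemma entails_trans g f h : f |- g -> g |- h -> f |- h.
Proof. by move=> fg gh; apply: entails_mp fg; apply: entails_weaken. Qed.

Lemma and_entailsl f g : and f g |- f.
Proof. by apply: T_ipl; apply: ipl_andl. Qed.

Lemma and_entailsr f g : and f g |- g.
Proof. by apply: T_ipl; apply: ipl_andr. Qed.

Lemma entails_and f g h : f |- g -> f |- h -> f |- and g h.
Proof.
move=> fg; apply: entails_mp; apply: entails_trans fg _.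
by apply: T_ipl; apply: ipl_andi.
Qed.

Lemma bot_entails f : bot |- f.
Proof. by apply: T_ipl; apply: ipl_bot. Qed.

(** This becomes residuation in the quotient. The converse composes [imp g (and f g)] with the given
    derivation, using the S axiom. *)
Lemma entails_imp f g h : f |- imp g h <-> and f g |- h.
Proof.
split=> [fgh|fgh].
  by apply: entails_mp (and_entailsr f g); apply: entails_trans fgh;
     apply: and_entailsl.
have fI : f |- imp g (and f g) by apply: T_ipl; apply: ipl_andi.
apply: entails_trans fI _; apply: (@T_mp (imp g (imp (and f g) h))).
  by apply: T_ipl; apply: ipl_s.
exact: entails_weaken.
Qed.

Definition equiv f g := f |- g /\ g |- f.

(** Classes are predicates, so extensionality turns provable equivalence into Leibniz equality and
    no quotient type is needed. *)
Definition class (f : F) : F -> Prop := equiv f.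

(** Saturating the image under [equiv] gives a full class again when [op] is congruent, without
    choosing representatives. *)
Definition lift (op : F -> F -> F) (X Y : F -> Prop) : F -> Prop :=
  fun h => exists f g, [/\ X f, Y g & equiv (op f g) h].

Lemma equiv_refl f : equiv f f.
Proof. by split; apply: entails_refl. Qed.

Lemma equiv_sym f g : equiv f g -> equiv g f.
Proof. by case. Qed.

Lemma equiv_trans g f h : equiv f g -> equiv g h -> equiv f h.
Proof.
by move=> [fg gf] [gh hg]; split; [apply: entails_trans fg gh|
  apply: entails_trans hg gf].
Qed.

Lemma class_eq f g : class f = class g <-> equiv f g.
Proof.
split=> [fg|fg]; first by rewrite -/(class f g) fg; apply: equiv_refl.
apply: functional_extensionality => h; apply: propositional_extensionality.
by split; apply: equiv_trans => //; apply: equiv_sym.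
Qed.

Definition congruent (op : F -> F -> F) :=
  forall f f' g g', equiv f f' -> equiv g g' -> equiv (op f g) (op f' g').

Lemma lift_class op f g :
  congruent op -> lift op (class f) (class g) = class (op f g).
Proof.
move=> op_congr.
apply: functional_extensionality => h; apply: propositional_extensionality.
split=> [[f' [g' [ff' gg']]]|fgh]; first by apply: equiv_trans; apply: op_congr.
by exists f, g; split=> //; apply: equiv_refl.
Qed.

Lemma congruent_and : congruent and.
Proof.
move=> f f' g g' [ff' f'f] [gg' g'g]; split; apply: entails_and;
  by [apply: entails_trans (and_entailsl _ _) _
     |apply: entails_trans (and_entailsr _ _) _].
Qed.

Lemma imp_mono f f' g g' : f' |- f -> g |- g' -> imp f g |- imp f' g'.
Proof.
move=> f'f gg'; apply/entails_imp; apply: entails_trans gg'.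
apply: (entails_mp (and_entailsl _ _)).
exact: entails_trans (and_entailsr _ _) f'f.
Qed.

Lemma congruent_imp : congruent imp.
Proof. by move=> f f' g g' [ff' f'f] [gg' g'g]; split; apply: imp_mono. Qed.

Lemma or_entailsl f g : f |- or f g.
Proof. by apply: T_ipl; apply: ipl_orl. Qed.

Lemma or_entailsr f g : g |- or f g.
Proof. by apply: T_ipl; apply: ipl_orr. Qed.

Lemma or_entails f g h : f |- h -> g |- h -> or f g |- h.
Proof. by move=> fh; apply: T_mp; apply: T_mp fh; apply: T_ipl; apply: ipl_ore. Qed.

Lemma congruent_or : congruent or.
Proof.
move=> f f' g g' [ff' f'f] [gg' g'g]; split; apply: or_entails;
  by [apply: entails_trans (or_entailsl _ _)|apply: entails_trans (or_entailsr _ _)].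
Qed.

(** Since [imp bot bot] is itself derivable, the theorems form a single class, the top one. *)
Lemma class_top f : class f = class (imp bot bot) <-> T f.
Proof.
rewrite class_eq; split=> [[_]|Tf].
  by move/T_mp; apply; apply: entails_refl.
by split; apply: entails_weaken; rewrite //; apply: entails_refl.
Qed.

Lemma class_le f g : lift and (class f) (class g) = class f <-> f |- g.
Proof.
rewrite (lift_class _ _ congruent_and) class_eq.
split=> [[_ ffg]|fg]; first exact: entails_trans ffg (and_entailsr _ _).
by split; [apply: and_entailsl|apply: entails_and fg; apply: entails_refl].
Qed.

(** [D] is left open so that the lemma covers both the generated subalgebra and the core;
    representatives reduce each law to a derivation. *)
Lemma class_brouwerian (D : (F -> Prop) -> Prop) :
  (forall X, D X -> exists f, X = class f) ->
  D (class bot) ->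
  (forall X Y, D X -> D Y -> D (lift and X Y)) ->
  (forall X Y, D X -> D Y -> D (lift imp X Y)) ->
  brouwerian_on D (lift and) (lift imp) (class bot).
Proof.
move=> repr Dbot Dand Dimp.
have liftM f g := lift_class f g congruent_and.
split=> // [_ /repr[f ->]|_ _ /repr[f ->] /repr[g ->]
  |_ _ _ /repr[f ->] /repr[g ->] /repr[h ->]|_ /repr[f ->]
  |_ _ _ /repr[f ->] /repr[g ->] /repr[h ->]].
- by apply/class_le; apply: entails_refl.
- rewrite !liftM; apply/class_eq.
  by split; apply: entails_and; do ?[apply: and_entailsl|apply: and_entailsr].
- rewrite !liftM; apply/class_eq; split; do ?apply: entails_and;
    do ?[exact: and_entailsl|exact: and_entailsr].
  + by apply: entails_trans (and_entailsr _ _) (and_entailsl _ _).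
  + by apply: entails_trans (and_entailsr _ _) (and_entailsr _ _).
  + by apply: entails_trans (and_entailsl _ _) (and_entailsl _ _).
  + by apply: entails_trans (and_entailsl _ _) (and_entailsr _ _).
- by apply/class_le; apply: bot_entails.
- by rewrite liftM (lift_class _ _ congruent_imp) !class_le entails_imp.
Qed.

(* The join need not be [or]: on the classes of standard formulas of dependence
   logic it is the tensor. *)
Lemma class_heyting (S : F -> Prop) (op : F -> F -> F)
    (D : (F -> Prop) -> Prop) :
  congruent op -> (forall f g, S f -> S g -> S (op f g)) ->
  (forall f g, S f -> S g -> f |- op f g) ->
  (forall f g, S f -> S g -> g |- op f g) ->
  (forall f g h, S f -> S g -> S h -> f |- h -> g |- h -> op f g |- h) ->
  (forall X, D X -> exists2 f, S f & X = class f) ->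
  D (class bot) ->
  (forall X Y, D X -> D Y -> D (lift and X Y)) ->
  (forall X Y, D X -> D Y -> D (lift imp X Y)) ->
  (forall X Y, D X -> D Y -> D (lift op X Y)) ->
  heyting_on D (lift and) (lift op) (lift imp) (class bot).
Proof.
move=> op_congr S_op opl opr op_lub repr Dbot Dand Dimp Dop.
have liftJ f g := lift_class f g op_congr.
have liftM f g := lift_class f g congruent_and.
split=> // [|_ _ /repr[f Sf ->] /repr[g Sg ->]
  |_ _ _ /repr[f Sf ->] /repr[g Sg ->] /repr[h Sh ->]
  |X Y DX DY|_ _ /repr[f Sf ->] /repr[g Sg ->]].
- by apply: class_brouwerian => // X /repr[f _ ->]; exists f.
- by rewrite !liftJ; apply/class_eq; split; apply: op_lub; auto.
- have Sfg := S_op _ _ Sf Sg; have Sgh := S_op _ _ Sg Sh.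
  have ffg := opl _ _ Sf Sg; have gfg := opr _ _ Sf Sg.
  have ggh := opl _ _ Sg Sh; have hgh := opr _ _ Sg Sh.
  rewrite !liftJ; apply/class_eq; split.
    apply: (op_lub); auto; first by apply: entails_trans ffg _; auto.
    by apply: (op_lub); auto; apply: entails_trans gfg _; auto.
  apply: (op_lub); auto; last by apply: entails_trans hgh _; auto.
  by apply: (op_lub); auto; apply: entails_trans ggh _; auto.
(* [op_lub] needs arguments in [S], and [S] is not assumed closed under [and]; so the meet is given
   a representative [h] in [S]. *)
- have [h Sh XYh] := repr _ (Dand _ _ DX DY).
  have [f Sf Xf] := repr _ DX; have [g Sg Yg] := repr _ DY.
  rewrite XYh; move: XYh; rewrite Xf Yg liftM liftJ !class_eq => -[_ hfg].
  split; last by auto.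
  apply: op_lub => //; first exact: entails_refl.
  exact: entails_trans hfg (and_entailsl _ _).
- by rewrite liftJ; apply/class_le; apply: opl.
Qed.

End Lindenbaum.

(** * Completeness *)

Section InqLindenbaum.
Variables (V : Type) (L : form V -> Prop).

Local Notation T := (inq L).

Lemma inq_axiom f : inqI_axiom f -> T f.
Proof. by move=> fax; apply: mp_base; left; apply: mp_base. Qed.

Lemma inq_ipl f : ipl_axiom Bot (@And V) (@Or V) (@Imp V) f -> T f.
Proof. by move=> fax; apply: inq_axiom; apply: inqI_ipl. Qed.

Lemma inq_mp f g : T (Imp f g) -> T f -> T g.
Proof. exact: mp_step. Qed.

Local Notation cls := (class (@Imp V) T).
Local Notation lft := (lift (@Imp V) T).

Definition inq_core (X : form V -> Prop) := exists2 f, standard f & X = cls f.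

Local Notation gen :=
  (inq_generated inq_core (lft (@And V)) (lft (@Or V)) (lft (@Imp V)) (cls Bot)).

Let liftM f g := lift_class inq_ipl inq_mp f g (congruent_and inq_ipl inq_mp).
Let liftI f g := lift_class inq_ipl inq_mp f g (congruent_imp inq_ipl inq_mp).
Let liftJ f g := lift_class inq_ipl inq_mp f g (congruent_or inq_ipl inq_mp).

(** Each [lift] of two classes is a class. The conjunct [True] matches the hypothesis of
    [class_heyting] when [S] holds of every formula. *)
Lemma inq_gen_class X : gen X -> exists2 f, True & X = cls f.
Proof.
elim=> [_ [f _ ->]||_ _ _ [f _ ->] _ [g _ ->]|_ _ _ [f _ ->] _ [g _ ->]
  |_ _ _ [f _ ->] _ [g _ ->]].
- by exists f.
- by exists Bot.
- by rewrite liftM; exists (And f g).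
- by rewrite liftJ; exists (Or f g).
- by rewrite liftI; exists (Imp f g).
Qed.

Lemma inq_lindenbaum_heyting :
  heyting_on gen (lft (@And V)) (lft (@Or V)) (lft (@Imp V)) (cls Bot).
Proof.
apply: (@class_heyting _ _ _ (@Or V) _ _ inq_ipl inq_mp (fun=> True)) => //.
- exact: congruent_or inq_ipl inq_mp.
- by move=> *; apply: or_entailsl inq_ipl _ _.
- by move=> *; apply: or_entailsr inq_ipl _ _.
- by move=> *; apply: or_entails inq_ipl inq_mp _ _ _ _ _.
- exact: inq_gen_class.
- exact: ig_bot.
- by move=> *; apply: ig_meet.
- by move=> *; apply: ig_imp.
- by move=> *; apply: ig_join.
Qed.

Lemma inq_lindenbaum_brouwerian :
  brouwerian_on inq_core (lft (@And V)) (lft (@Imp V)) (cls Bot).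
Proof.
apply: (class_brouwerian inq_ipl inq_mp) => [_ [f _ ->]||
  _ _ [f fs ->] [g gs ->]|_ _ [f fs ->] [g gs ->]].
- by exists f.
- by exists Bot.
- by rewrite liftM; exists (And f g); rewrite //= fs.
- by rewrite liftI; exists (Imp f g); rewrite //= fs.
Qed.

Lemma inq_lindenbaum_split X Y Z : inq_core X -> gen Y -> gen Z ->
  lft (@Imp V) X (lft (@Or V) Y Z)
  = lft (@Or V) (lft (@Imp V) X Y) (lft (@Imp V) X Z).
Proof.
move=> [a a_std ->] /inq_gen_class[f _ ->] /inq_gen_class[g _ ->].
rewrite !(liftI, liftJ); apply/(class_eq inq_ipl inq_mp).
(* Only this direction uses that [a] is standard; the converse is monotonicity of implication in its
   consequent. *)
split; first by apply: inq_axiom; apply: inqI_split.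
by apply: (or_entails inq_ipl inq_mp);
  apply: (imp_mono inq_ipl inq_mp (entails_refl inq_ipl inq_mp _));
  [apply: or_entailsl inq_ipl _ _|apply: or_entailsr inq_ipl _ _].
Qed.

Definition inq_lindenbaum : inqAlgebra :=
  InqAlgebra inq_lindenbaum_heyting inq_lindenbaum_brouwerian
             inq_lindenbaum_split.

(** The truth lemma is stated for any substitution: validity of [L] needs a general [s], and
    completeness takes [s] to be [Atom]. *)
Lemma inq_lindenbaum_eval (s : V -> form V) f :
  ia_eval (A := inq_lindenbaum) (fun p => cls (s p)) f = cls (subst s f).
Proof.
elim: f => //= f -> g ->; [exact: liftM|exact: liftJ|exact: liftI].
Qed.

Lemma inq_lindenbaum_top : ia_top inq_lindenbaum = cls (Imp Bot Bot).
Proof. exact: liftI. Qed.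

Lemma inq_lindenbaumP : closed_std_subst L -> is_inq_algebra L inq_lindenbaum.
Proof.
move=> L_subst f Lf mu mu_core.
(* Choosing a standard representative of each [mu p] exhibits [mu] as the valuation induced by a
   standard substitution. *)
have /functional_choice[s sP] p : exists f, standard f /\ mu p = cls f.
  by case: (mu_core p) => g; exists g.
have -> : mu = fun p => cls (s p).
  by apply: functional_extensionality => p; case: (sP p).
rewrite inq_lindenbaum_eval inq_lindenbaum_top; apply/(class_top inq_ipl inq_mp).
by apply: mp_base; right; apply: L_subst => // p; case: (sP p).
Qed.

Lemma subst_Atom (f : form V) : subst (@Atom V) f = f.
Proof. by elim: f => //= f -> g ->. Qed.

Lemma inq_complete f : ia_valid inq_lindenbaum f -> T f.
Proof.
move/(_ (fun p => cls (Atom p))); rewrite inq_lindenbaum_eval subst_Atom.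
rewrite inq_lindenbaum_top => f_top; apply/(class_top inq_ipl inq_mp); apply: f_top.
by move=> p; exists (Atom p).
Qed.

End InqLindenbaum.

(** * The Lindenbaum algebra of a dependence logic *)

Section DinqLindenbaum.
Variables (V : Type) (L : dform V -> Prop).

Local Notation T := (dinq L).

Lemma dinq_axiom f : dinqI_axiom f -> T f.
Proof. by move=> fax; apply: mp_base; left; apply: mp_base. Qed.

Lemma dinq_ipl f : ipl_axiom DBot (@DAnd V) (@DOr V) (@DImp V) f -> T f.
Proof. by move=> fax; apply: dinq_axiom; apply: dinqI_ipl. Qed.

Lemma dinq_mp f g : T (DImp f g) -> T f -> T g.
Proof. exact: mp_step. Qed.

Local Notation cls := (class (@DImp V) T).
Local Notation lft := (lift (@DImp V) T).

Definition dinq_core (X : dform V -> Prop) := exists2 f, dstandard f & X = cls f.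

Local Notation gen :=
  (dep_generated dinq_core (lft (@DAnd V)) (lft (@DOr V)) (lft (@DImp V))
     (lft (@DTen V)) (cls DBot)).

(** The monotonicity axiom covers arbitrary formulas, so the tensor respects equivalence on the
    whole generated subalgebra and not just on the core. *)
Lemma ten_mono f g h k :
  T (DImp f h) -> T (DImp g k) -> T (DImp (DTen f g) (DTen h k)).
Proof.
by move=> fh; apply: dinq_mp; apply: dinq_mp fh; apply: dinq_axiom;
   apply: dinqI_ten_mon.
Qed.

Lemma congruent_ten : congruent (@DImp V) T (@DTen V).
Proof. by move=> f f' g g' [ff' f'f] [gg' g'g]; split; apply: ten_mono. Qed.

Let liftM f g := lift_class dinq_ipl dinq_mp f g (congruent_and dinq_ipl dinq_mp).
Let liftI f g := lift_class dinq_ipl dinq_mp f g (congruent_imp dinq_ipl dinq_mp).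
Let liftJ f g := lift_class dinq_ipl dinq_mp f g (congruent_or dinq_ipl dinq_mp).
Let liftT f g := lift_class dinq_ipl dinq_mp f g congruent_ten.

Lemma dinq_gen_class X : gen X -> exists2 f, True & X = cls f.
Proof.
elim=> [_ [f _ ->]||_ _ _ [f _ ->] _ [g _ ->]|_ _ _ [f _ ->] _ [g _ ->]
  |_ _ _ [f _ ->] _ [g _ ->]|_ _ _ [f _ ->] _ [g _ ->]].
- by exists f.
- by exists DBot.
- by rewrite liftM; exists (DAnd f g).
- by rewrite liftJ; exists (DOr f g).
- by rewrite liftI; exists (DImp f g).
- by rewrite liftT; exists (DTen f g).
Qed.

Lemma dinq_lindenbaum_heyting :
  heyting_on gen (lft (@DAnd V)) (lft (@DOr V)) (lft (@DImp V)) (cls DBot).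
Proof.
apply: (@class_heyting _ _ _ (@DOr V) _ _ dinq_ipl dinq_mp (fun=> True)) => //.
- exact: congruent_or dinq_ipl dinq_mp.
- by move=> *; apply: or_entailsl dinq_ipl _ _.
- by move=> *; apply: or_entailsr dinq_ipl _ _.
- by move=> *; apply: or_entails dinq_ipl dinq_mp _ _ _ _ _.
- exact: dinq_gen_class.
- exact: dg_bot.
- by move=> *; apply: dg_meet.
- by move=> *; apply: dg_imp.
- by move=> *; apply: dg_join.
Qed.

Lemma dinq_lindenbaum_core_heyting :
  heyting_on dinq_core (lft (@DAnd V)) (lft (@DTen V)) (lft (@DImp V)) (cls DBot).
Proof.
(* [(@DOr V)] is the disjunction of the ambient calculus; the join [op] is read off the goal as the
   tensor. Its axioms make it a least upper bound on standard formulas. *)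
apply: (@class_heyting _ _ _ (@DOr V) _ _ dinq_ipl dinq_mp
          (fun f => dstandard f)) => //.
- exact: congruent_ten.
- by move=> f g /= -> ->.
- by move=> f g fs gs; apply: dinq_axiom; apply: dinqI_ten_intro.
(* The axioms inject only on the left; commutation supplies the right injection. *)
- move=> f g fs gs; apply: (entails_trans dinq_ipl dinq_mp (g := DTen g f)).
    by apply: dinq_axiom; apply: dinqI_ten_intro.
  by apply: dinq_axiom; apply: dinqI_ten_comm.
- move=> f g h fs gs hs fh; apply: dinq_mp; apply: dinq_mp fh.
  by apply: dinq_axiom; apply: dinqI_ten_elim.
- by exists DBot.
- move=> _ _ [f fs ->] [g gs ->].
  by rewrite liftM; exists (DAnd f g); rewrite //= fs.
- move=> _ _ [f fs ->] [g gs ->].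
  by rewrite liftI; exists (DImp f g); rewrite //= fs.
- move=> _ _ [f fs ->] [g gs ->].
  by rewrite liftT; exists (DTen f g); rewrite //= fs.
Qed.

Lemma dinq_lindenbaum_split X Y Z : dinq_core X -> gen Y -> gen Z ->
  lft (@DImp V) X (lft (@DOr V) Y Z)
  = lft (@DOr V) (lft (@DImp V) X Y) (lft (@DImp V) X Z).
Proof.
move=> [a a_std ->] /dinq_gen_class[f _ ->] /dinq_gen_class[g _ ->].
rewrite !(liftI, liftJ); apply/(class_eq dinq_ipl dinq_mp).
split; first by apply: dinq_axiom; apply: dinqI_split.
by apply: (or_entails dinq_ipl dinq_mp);
  apply: (imp_mono dinq_ipl dinq_mp (entails_refl dinq_ipl dinq_mp _));
  [apply: or_entailsl dinq_ipl _ _|apply: or_entailsr dinq_ipl _ _].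
Qed.

Lemma dinq_lindenbaum_dist X Y Z : gen X -> gen Y -> gen Z ->
  lft (@DTen V) X (lft (@DOr V) Y Z)
  = lft (@DOr V) (lft (@DTen V) X Y) (lft (@DTen V) X Z).
Proof.
move=> /dinq_gen_class[f _ ->] /dinq_gen_class[g _ ->] /dinq_gen_class[h _ ->].
rewrite !(liftT, liftJ); apply/(class_eq dinq_ipl dinq_mp).
(* The converse applies monotonicity of the tensor to the two injections of [DOr]. *)
split; first by apply: dinq_axiom; apply: dinqI_ten_dist.
by apply: (or_entails dinq_ipl dinq_mp);
  apply: ten_mono (entails_refl dinq_ipl dinq_mp _) _;
  [apply: or_entailsl dinq_ipl _ _|apply: or_entailsr dinq_ipl _ _].
Qed.

Lemma dinq_lindenbaum_mon X Y Z W : gen X -> gen Y -> gen Z -> gen W ->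
  lft (@DImp V) (lft (@DImp V) X Z)
    (lft (@DImp V) (lft (@DImp V) Y W)
      (lft (@DImp V) (lft (@DTen V) X Y) (lft (@DTen V) Z W)))
  = lft (@DImp V) (cls DBot) (cls DBot).
Proof.
move=> /dinq_gen_class[f _ ->] /dinq_gen_class[g _ ->].
move=> /dinq_gen_class[h _ ->] /dinq_gen_class[k _ ->].
rewrite !(liftT, liftI); apply/(class_top dinq_ipl dinq_mp).
by apply: dinq_axiom; apply: dinqI_ten_mon.
Qed.

Definition dinq_lindenbaum : depAlgebra :=
  DepAlgebra dinq_lindenbaum_heyting dinq_lindenbaum_core_heyting
    dinq_lindenbaum_split dinq_lindenbaum_dist dinq_lindenbaum_mon.

Lemma dinq_lindenbaum_eval (s : V -> dform V) f :
  da_eval (A := dinq_lindenbaum) (fun p => cls (s p)) f = cls (dsubst s f).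
Proof.
elim: f => //= f -> g ->; [exact: liftM|exact: liftJ|exact: liftI|exact: liftT].
Qed.

Lemma dinq_lindenbaum_top : da_top dinq_lindenbaum = cls (DImp DBot DBot).
Proof. exact: liftI. Qed.

Lemma dinq_lindenbaumP :
  dclosed_std_subst L -> is_dinq_algebra L dinq_lindenbaum.
Proof.
move=> L_subst f Lf mu mu_core.
have /functional_choice[s sP] p : exists f, dstandard f /\ mu p = cls f.
  by case: (mu_core p) => g; exists g.
have -> : mu = fun p => cls (s p).
  by apply: functional_extensionality => p; case: (sP p).
rewrite dinq_lindenbaum_eval dinq_lindenbaum_top.
apply/(class_top dinq_ipl dinq_mp).
by apply: mp_base; right; apply: L_subst => // p; case: (sP p).
Qed.

Lemma dsubst_DAtom (f : dform V) : dsubst (@DAtom V) f = f.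
Proof. by elim: f => //= f -> g ->. Qed.

Lemma dinq_complete f : da_valid dinq_lindenbaum f -> T f.
Proof.
move/(_ (fun p => cls (DAtom p))); rewrite dinq_lindenbaum_eval dsubst_DAtom.
rewrite dinq_lindenbaum_top => f_top; apply/(class_top dinq_ipl dinq_mp).
by apply: f_top => p; exists (DAtom p).
Qed.

End DinqLindenbaum.

Theorem theorem2p15 (V : countType) :
  (forall L : form V -> Prop,
     (forall f, L f -> standard f) -> closed_std_subst L ->
     forall f : form V,
       inq L f <-> (forall A : inqAlgebra, is_inq_algebra L A -> ia_valid A f))
  /\
  (forall L : dform V -> Prop,
     (forall f, L f -> dstandard f) -> dclosed_std_subst L ->
     forall f : dform V,
       dinq L f <-> (forall A : depAlgebra, is_dinq_algebra L A -> da_valid A f)).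
Proof.
split=> L _ L_subst f; split.
- by move=> Lf A AL; apply: inq_sound Lf.
(* Validity is used in one algebra only, the Lindenbaum algebra of [L] itself. *)
- by move=> f_valid; apply: inq_complete; apply/f_valid/inq_lindenbaumP.
- by move=> Lf A AL; apply: dinq_sound Lf.
- by move=> f_valid; apply: dinq_complete; apply/f_valid/dinq_lindenbaumP.
Qed.
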